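(* There are functions $\delta_1,\delta_2:(0,\infty)\to\mathbb R$ with $\delta_1(K)\to0$ and $\delta_2(K)\to0$ as $K\to\infty$ such that the following holds. Let $(X,\mathsf d)$ be a finite metric space and let $r>0$. Suppose that: (1) (homogeneous) for every $s\in\mathbb R$, all balls of radius $s$ in $X$ have the same volume, denoted $\mathrm{vol}(s)$. Suppose further that there exist $t\in(0,r)$ and $K>0$ such that: (2) (exponential growth) $\frac{\mathrm{vol}(r-t)}{\mathrm{vol}(r)}\le e^{-K}$; and (3) (small intersection volume) for any $a,b\in X$ with $r-t<\mathsf d(a,b)\le r$, $\frac{|B(a,r)\cap B(b,r)|}{\mathrm{vol}(r)}\le e^{-K}$. Then there is an $(X,\mathsf d,r)$-code of size at least $(1-\delta_1(K))\,K\cdot\frac{|X|}{\mathrm{vol}(r)}$, and the number of $(X,\mathsf d,r)$-codes is at least $\exp\left(\left(\frac18+\delta_2(K)\right)K^2\cdot\frac{|X|}{\mathrm{vol}(r)}\right)$.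
   Context: $B(a,s)=\{x\in X:\mathsf d(x,a)\le s\}$, and the volume of a set is its cardinality. An $(X,\mathsf d,r)$-code is a subset $C\subseteq X$ such that $\mathsf d(c,c')>r$ for any two distinct $c,c'\in C$. *)

(* Defs.v *)
From HB Require Import structures.
From mathcomp Require Import all_boot all_order all_algebra.
From mathcomp Require Import all_classical all_reals all_analysis.

Set Implicit Arguments.
Unset Strict Implicit.
Unset Printing Implicit Defensive.

Import Order.TTheory GRing.Theory Num.Theory.
Import numFieldNormedType.Exports.

Local Open Scope ring_scope.

(* The metric space may be empty. *)
#[short(type="finMetricType")]
HB.structure Definition FiniteMetric (R : numDomainType) :=
  {T of Finite T & Metric R T}.

(* The ball of the library, [ball a s], is open, and [closed_ball a s] is its
   topological closure, which in a finite space is the open ball again. *)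
Definition cball (R : realType) (X : finMetricType R) (a : X) (s : R) :
  {set X} := [set x : X | mdist x a <= s]%SET.

Definition is_code (R : realType) (X : finMetricType R) (r : R)
  (C : {set X}) : bool :=
  [forall c in C, forall c' in C, (c != c') ==> (r < mdist c c')].

(* Main.v *)
Require Import Defs.
From HB Require Import structures.
From mathcomp Require Import all_boot all_order all_algebra.
From mathcomp Require Import all_classical all_reals all_analysis.
From mathcomp Require Import ring lra.

(** A code is a stable set of the graph joining points at distance at most r.
    Loops are kept, so that degrees are volumes of balls and every degree is
    vol r. The mechanism is Shearer's: to build a stable set in S, pick a point
    v of S, delete its ball and continue. Averaging over v, deletion removes
    from S the average degree many points, while inclusion and exclusion
    expresses the number of adjacent pairs that survive through the squares of
    the degrees and the number of triangles. Few triangles mean that balls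
    contain few edges, so that deletions destroy many edges and the rest
    becomes sparser.

    Few triangles are what the two hypotheses give: a pair at distance more
    than r - t has at most exp (- K) * vol r common neighbours, and the pairs
    at smaller distance are at most exp (- K) * vol r at each point, with at
    most a full degree of common neighbours. Hence triangles number at most
    A = 2 * exp (- K) * vol r times the adjacent pairs, in every subset
    ([triples_le]).

    With n points and average degree d, the stable set should have about
    n * ln (d / A) / d points. Shearer's function is replaced by the sum
    [potential] of w * n / (b_j + d) over a geometric progression b_j starting
    above A. It is a Riemann sum of the integral of ds / (exp s + d), which is
    about ln (d / b_0) / d. Each summand is convex for an elementary reason, a
    square being nonnegative, and the loss in one deletion is a sum that
    telescopes; so [potential_step] needs no analysis: the potential of S is at
    most one plus the average potential after a deletion. Induction yields a
    stable set as large as the potential ([stable_card_ge]). At d = vol r the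
    progression runs over a range of logarithmic length close to K, hence the
    bound K * |X| / vol r.

    For the number of codes, the same induction keeps track of choices
    ([expR_le_card_stables]). If no code has more than M points, a code arises
    from at most M pairs of a first point and a code outside its ball, so each
    deletion from a set of n points multiplies the count by n / M on (geometric)
    average. While more than M * exp ell points remain this is a gain of ell per
    unit of potential. Starting the progression at exp (- K / 2) * vol r makes
    the potential of the sets below that size negligible and leaves about
    K / 2 * |X| / vol r units; with ell = 3 K / 8 the exponent has leading
    constant 9 / 64, which exceeds 1 / 8. Codes with more than
    M = K ^ 2 * |X| / vol r points may be excluded, because the subsets of one
    such code are already numerous enough. *)

Set Implicit Arguments.
Unset Strict Implicit.
Unset Printing Implicit Defensive.

Import Order.TTheory GRing.Theory Num.Theory.
Import numFieldNormedType.Exports.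

Local Open Scope ring_scope.

(** * Local counts in a reflexive graph *)

Section LocalCounts.
Context (F : realFieldType) (T : finType) (e : rel T).
Implicit Types (S : {set T}) (v x y : T).

Let adj x y : F := (e x y)%:R.

Definition deg S x : F := \sum_(y in S) (e x y)%:R.

Definition pairs S : F := \sum_(x in S) deg S x.

(** Ordered triples with repetitions: since the graph is reflexive, the
    degenerate triples are counted as well. *)
Definition triples S : F :=
  \sum_(v in S) \sum_(x in S) \sum_(y in S)
     (e v x)%:R * (e v y)%:R * (e x y)%:R.

Definition away S v : {set T} := [set x in S | ~~ e v x]%SET.

Lemma deg_ge0 S x : 0 <= deg S x.
Proof. by apply: sumr_ge0 => y _; rewrite ler0n. Qed.

Lemma pairs_ge0 S : 0 <= pairs S.
Proof. by apply: sumr_ge0 => x _; exact: deg_ge0. Qed.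

Lemma degE S x : deg S x = #|[set y in S | e x y]%SET|%:R.
Proof.
rewrite /deg -sum1_card natr_sum big_mkcond [RHS]big_mkcond /=.
by apply: eq_bigr => y _; rewrite inE; case: (y \in S); case: (e x y).
Qed.

Lemma sum_away S v (f : T -> F) :
  \sum_(x in away S v) f x = \sum_(x in S) (1 - adj v x) * f x.
Proof.
rewrite big_mkcond [RHS]big_mkcond /=; apply: eq_bigr => x _.
rewrite inE /adj; case: (x \in S) => //=; case: (e v x) => /=; ring.
Qed.

Lemma card_sum1 S : #|S|%:R = \sum_(x in S) (1 : F).
Proof. by rewrite -sum1_card natr_sum. Qed.

Lemma sum_card_away S :
  \sum_(v in S) (#|away S v|%:R : F) = #|S|%:R ^+ 2 - pairs S.
Proof.
under eq_bigr do rewrite card_sum1 sum_away.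
under eq_bigr do under eq_bigr do rewrite mulr1.
under eq_bigr do rewrite sumrB -card_sum1.
by rewrite sumrB sumr_const expr2 [in RHS]mulr_natl.
Qed.

Hypothesis e_sym : symmetric e.

(** Inclusion and exclusion on whether each end of a pair lies in the ball
    around v; the two middle terms agree by symmetry. *)
Lemma sum_pairs_away S :
  \sum_(v in S) pairs (away S v) =
  #|S|%:R * pairs S - 2 * (\sum_(x in S) deg S x ^+ 2) + triples S.
Proof.
have pairsE v : pairs (away S v) =
    pairs S - 2 * (\sum_(x in S) adj v x * deg S x)
    + \sum_(x in S) \sum_(y in S) adj v x * adj v y * adj x y.
  rewrite /pairs sum_away /deg.
  transitivity (\sum_(x in S) \sum_(y in S)
    (adj x y - adj v x * adj x y - adj v y * adj x y
     + adj v x * adj v y * adj x y)).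
    apply: eq_bigr => x _; rewrite sum_away mulr_sumr.
    by apply: eq_bigr => y _; rewrite -/(adj x y); ring.
  under eq_bigr do rewrite big_split /= !sumrB.
  rewrite big_split /= !sumrB; congr (_ + _).
  rewrite [X in _ - _ - X]exchange_big /= mulr2n mulrDl mul1r opprD addrA.
  congr (_ - _ - _); apply: eq_bigr => x _; rewrite mulr_sumr //.
  by apply: eq_bigr => y _; rewrite /adj (e_sym y x).
under eq_bigr do rewrite pairsE.
rewrite big_split /= sumrB sumr_const -[_ *+ #|_|]mulr_natl -mulr_sumr.
congr (_ - 2 * _ + _).
rewrite exchange_big /=; apply: eq_bigr => x _; rewrite -mulr_suml expr2.
by congr (_ * _); apply: eq_bigr => y _; rewrite /adj e_sym.
Qed.

Lemma sqr_pairs_le S :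
  pairs S ^+ 2 <= #|S|%:R * \sum_(x in S) deg S x ^+ 2.
Proof.
have [->|S0] := eqVneq S finset.set0.
  by rewrite /pairs big_set0 cards0 expr0n /= mul0r.
have n0 : 0 < #|S|%:R :> F by rewrite ltr0n card_gt0.
set Q := \sum_(x in S) _; rewrite -subr_ge0 -(pmulr_rge0 _ n0).
suff -> : #|S|%:R * (#|S|%:R * Q - pairs S ^+ 2)
    = \sum_(x in S) (#|S|%:R * deg S x - pairs S) ^+ 2.
  by apply: sumr_ge0 => x _; exact: sqr_ge0.
transitivity (\sum_(x in S) (#|S|%:R ^+ 2 * deg S x ^+ 2
    - 2 * #|S|%:R * pairs S * deg S x + pairs S ^+ 2)).
  rewrite big_split /= sumrB -!mulr_sumr -/Q -/(pairs S) sumr_const.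
  by rewrite -[_ *+ #|S|]mulr_natl; ring.
by apply: eq_bigr => x _; ring.
Qed.

(** The triples through a pair at small distance are bounded by the degree of
    one of its ends rather than by a constant; both that bound and the bound
    on the other pairs pass to every subset. *)
Lemma triples_le (inner : rel T) (a : F) S :
  (forall v, #|[set x | inner v x]%SET|%:R <= a) ->
  (forall v x, e v x -> ~~ inner v x ->
     #|[set y | e v y && e x y]%SET|%:R <= a) ->
  triples S <= 2 * a * pairs S.
Proof.
move=> innera outera.
have a0 v : 0 <= a by apply: le_trans (innera v); rewrite ler0n.
rewrite /triples /pairs mulr_sumr; apply: ler_sum => v vS.
have codeg x : e v x -> ~~ inner v x ->
    \sum_(y in S) adj v y * adj x y <= a.
  move=> evx ivx; apply: le_trans (outera v x evx ivx).
  rewrite -sum1_card natr_sum big_mkcond [leRHS]big_mkcond /=.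
  apply: ler_sum => y _; rewrite inE /adj.
  by case: (y \in S); case: (e v y); case: (e x y);
    rewrite /= ?mulr0 ?mulr1 ?ler01.
apply: (@le_trans _ _ (\sum_(x in S)
    ((inner v x)%:R * deg S v + adj v x * a))).
  apply: ler_sum => x xS.
  under eq_bigr do rewrite -mulrA.
  rewrite -mulr_sumr -/(adj v x).
  have [evx|evx] := boolP (e v x); last first.
    by rewrite /adj (negbTE evx) !mul0r addr0 mulr_ge0 ?ler0n ?deg_ge0.
  have [ivx|ivx] := boolP (inner v x); rewrite /adj evx !mul1r.
    apply: (@le_trans _ _ (deg S v)); last by rewrite lerDl (a0 v).
    apply: ler_sum => y _.
    by rewrite -natrM ler_nat; case: (e v y); case: (e x y).
  by rewrite mul0r add0r; exact: codeg.
rewrite big_split /= -!mulr_suml -/(deg S v).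
rewrite (_ : 2 * a * _ = a * deg S v + deg S v * a); last by ring.
rewrite lerD2r ler_wpM2r ?deg_ge0 //; apply: le_trans (innera v).
rewrite -sum1_card natr_sum big_mkcond [leRHS]big_mkcond /=.
by apply: ler_sum => x _; rewrite inE; case: (x \in S); case: (inner v x).
Qed.

End LocalCounts.

(** * The potential *)

Section Potential.
Context (F : realFieldType) (b0 rho : F).
Hypotheses (b0_gt0 : 0 < b0) (rho_gt1 : 1 < rho).

Let b j := b0 * rho ^+ j.

Let rho_gt0 : 0 < rho. Proof. exact: lt_trans ltr01 rho_gt1. Qed.

Let b_gt0 j : 0 < b j. Proof. by rewrite /b mulr_gt0 ?exprn_gt0. Qed.

Let b_ge j : b0 <= b j.
Proof. by rewrite /b ler_peMr ?exprn_ege1 ?ltW. Qed.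

(** Up to the factor 1 - 1 / rho, each summand is at most a difference of
    consecutive values of 1 / (b j + d), so the sum telescopes. The case d > 0
    controls the loss in [potential_step], the case d = 0 gives
    [potential_le_card]. *)
Lemma sum_ladder_le (d : F) J : 0 <= d ->
  (1 - rho^-1) * (\sum_(j < J) b j / (b j + d) ^+ 2) <= (b0 + d)^-1.
Proof.
move=> d0.
have D_gt0 j : 0 < b j + d by rewrite ltr_wpDr.
suff : (1 - rho^-1) * (\sum_(j < J) b j / (b j + d) ^+ 2) <=
       (b0 + d)^-1 - (b J + d)^-1.
  by move/le_trans; apply; rewrite gerBl invr_ge0 ltW.
elim: J => [|J IH]; first by rewrite big_ord0 mulr0 /b expr0 mulr1 subrr.
rewrite big_ord_recr mulrDr /=.
suff step : (1 - rho^-1) * (b J / (b J + d) ^+ 2) <=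
    (b J + d)^-1 - (b J.+1 + d)^-1 by lra.
have bS : b J.+1 = rho * b J by rewrite /b exprS; ring.
have DS : b J.+1 + d <= rho * (b J + d).
  by rewrite bS mulrDr lerD2l ler_peMl ?(ltW rho_gt1).
have -> : (b J + d)^-1 - (b J.+1 + d)^-1 =
    (rho - 1) * b J / ((b J + d) * (b J.+1 + d)).
  have := D_gt0 J.+1; have := D_gt0 J; rewrite bS => /gt_eqF h1 /gt_eqF h2.
  by field; rewrite h1 h2.
have -> : (1 - rho^-1) * (b J / (b J + d) ^+ 2) =
    (rho - 1) * b J / ((b J + d) * (rho * (b J + d))).
  by have := D_gt0 J => /gt_eqF h1; field; rewrite h1 gt_eqF.
apply: ler_wpM2l; first by rewrite mulr_ge0 ?subr_ge0 ?ltW.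
rewrite lef_pV2 ?posrE ?mulr_gt0 //.
by rewrite ler_wpM2l // ltW.
Qed.

(** The graph of x ^ 2 / D, convex in x and D jointly, lies above its tangent
    along the ray x = tau * D; the difference is a square. *)
Lemma sqr_div_ge (x D tau : F) : 0 < D ->
  2 * tau * x - tau ^+ 2 * D <= x ^+ 2 / D.
Proof.
move=> D0; rewrite ler_pdivlMr // -subr_ge0.
rewrite (_ : _ - _ = (x - tau * D) ^+ 2) ?sqr_ge0 //; ring.
Qed.

Context (T : finType) (e : rel T).
Hypothesis e_sym : symmetric e.
Implicit Types (S : {set T}).

(** With average degree d = pairs S / #|S|, this is #|S| times the sum of
    w / (b j + d), which for suitable w is a Riemann sum of
    ln (1 + d / b0) / d. Written in #|S| and pairs S, each summand is convex in
    these two additive counts. *)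
Definition potential (w : F) (J : nat) S : F :=
  w * \sum_(j < J) #|S|%:R ^+ 2 / (b j * #|S|%:R + pairs F e S).

Lemma potential0 w J : potential w J finset.set0 = 0.
Proof.
rewrite /potential big1 ?mulr0 // => j _.
by rewrite cards0 expr0n /= mul0r.
Qed.

Lemma potential_ge_linear w J S (tau : nat -> F) : 0 <= w ->
  w * \sum_(j < J) (2 * tau j * #|S|%:R
                    - tau j ^+ 2 * (b j * #|S|%:R + pairs F e S))
  <= potential w J S.
Proof.
move=> w0; rewrite /potential ler_wpM2l //; apply: ler_sum => j _.
have [->|S0] := eqVneq S finset.set0.
  rewrite /pairs big_set0 cards0 expr0n /= !mulr0 mul0r addr0 mulr0 subrr.
  by [].
apply: sqr_div_ge; rewrite ltr_pwDl ?pairs_ge0 //.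
by rewrite mulr_gt0 ?b_gt0 // ltr0n card_gt0.
Qed.

Lemma potential_le_card w J S : 0 <= w -> w <= 1 - rho^-1 ->
  potential w J S <= #|S|%:R / b0.
Proof.
move=> w0 w1; have [->|S0] := eqVneq S finset.set0.
  by rewrite potential0 cards0 mul0r.
have n0 : 0 < #|S|%:R :> F by rewrite ltr0n card_gt0.
apply: (@le_trans _ _ ((1 - rho^-1) *
    (#|S|%:R * \sum_(j < J) b j / (b j + 0) ^+ 2))).
  apply: ler_pM => //; first by apply: sumr_ge0 => j _;
    rewrite divr_ge0 ?sqr_ge0 // addr_ge0 ?pairs_ge0 // mulr_ge0 //
      (ltW (b_gt0 j)).
  rewrite mulr_sumr; apply: ler_sum => j _.
  rewrite (_ : #|S|%:R * _ = #|S|%:R ^+ 2 / (b j * #|S|%:R)); last first.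
    by rewrite addr0; field; rewrite (gt_eqF n0) (gt_eqF (b_gt0 j)).
  have bn0 : 0 < b j * #|S|%:R by exact: mulr_gt0.
  rewrite ler_wpM2l ?sqr_ge0 // lef_pV2 ?posrE ?lerDl ?pairs_ge0 //.
  by rewrite ltr_pwDl ?pairs_ge0.
rewrite mulrCA ler_pM2l // -[X in _ <= X^-1]addr0.
exact: sum_ladder_le.
Qed.

(** Linearising each summand at the values on S leaves, per deletion, a loss of
    (b j + A) * d / (b j + d) ^ 2 beside the term that reproduces the
    potential: the squares of the degrees give at least d ^ 2, and triangles
    contribute A. The losses, with their weights w, add up to at most 1 by
    [sum_ladder_le], the condition A <= kappa * b0 absorbing A into b j. *)
Lemma potential_step (A kappa w : F) J S :
  0 <= A -> A <= kappa * b0 -> 0 <= w -> w * (1 + kappa) <= 1 - rho^-1 ->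
  triples F e S <= A * pairs F e S ->
  #|S|%:R * potential w J S <=
  #|S|%:R + \sum_(v in S) potential w J (away e S v).
Proof.
move=> A0 Akappa w0 wk tri.
have [->|S0] := eqVneq S finset.set0.
  by rewrite cards0 mul0r big_set0 addr0.
set n : F := #|S|%:R; set m := pairs F e S in tri *.
have n0 : 0 < n by rewrite ltr0n card_gt0.
have m0 : 0 <= m by exact: pairs_ge0.
pose D j := b j * n + m.
have D0 j : 0 < D j by rewrite ltr_pwDl // (mulr_gt0 (b_gt0 j)).
pose tau j := n / D j.
have kappa0 : 0 <= kappa.
  by rewrite -(pmulr_lge0 _ b0_gt0); exact: le_trans A0 Akappa.
(* Each summand is replaced by its tangent at the values taken on S itself. *)
apply: (@le_trans _ _ (n + \sum_(v in S) w * \sum_(j < J)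
   (2 * tau j * #|away e S v|%:R - tau j ^+ 2 *
     (b j * #|away e S v|%:R + pairs F e (away e S v))))); last first.
  by rewrite lerD2l; apply: ler_sum => v _; exact: potential_ge_linear.
have sumE : \sum_(v in S) w * \sum_(j < J)
   (2 * tau j * #|away e S v|%:R - tau j ^+ 2 *
     (b j * #|away e S v|%:R + pairs F e (away e S v))) =
   w * \sum_(j < J) (2 * tau j * (n ^+ 2 - m) - tau j ^+ 2 *
     (b j * (n ^+ 2 - m) + (n * m - 2 * (\sum_(x in S) deg F e S x ^+ 2)
        + triples F e S))).
  rewrite -mulr_sumr exchange_big /=; congr (_ * _); apply: eq_bigr => j _.
  rewrite -sum_card_away -sum_pairs_away // sumrB -!mulr_sumr big_split /=.
  by rewrite -mulr_sumr.
rewrite {}sumE.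
have Qge : m ^+ 2 / n <= \sum_(x in S) deg F e S x ^+ 2.
  by rewrite ler_pdivrMr // mulrC; exact: sqr_pairs_le.
have [d d0 mE] : exists2 d, 0 <= d & m = n * d.
  exists (m / n); first by rewrite divr_ge0 // ltW.
  by field; rewrite gt_eqF.
apply: (@le_trans _ _ (n + w * \sum_(j < J)
   (n * (n ^+ 2 / D j) - n * ((1 + kappa) * (d * (b j / (b j + d) ^+ 2)))))).
  rewrite sumrB -mulr_sumr mulrBr /potential -/n -/m mulrCA.
  rewrite addrCA lerDl subr_ge0 -!mulr_sumr mulrCA -[leRHS]mulr1.
  rewrite ler_wpM2l ?(ltW n0) // !mulrA.
  set s := \sum_(j < J) _.
  apply: (@le_trans _ _ ((1 - rho^-1) * (d * s))).
    rewrite -mulrA ler_wpM2r // mulr_ge0 //; apply: sumr_ge0 => j _.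
    by rewrite divr_ge0 ?sqr_ge0 // ltW.
  rewrite mulrCA; apply: (@le_trans _ _ (d * (b0 + d)^-1)).
    by rewrite ler_wpM2l //; exact: sum_ladder_le.
  by rewrite ler_pdivrMr ?mul1r ?lerDr ?(ltW b0_gt0) // ltr_pwDl.
rewrite lerD2l ler_wpM2l //; apply: ler_sum => j _.
have Dn : D j = n * (b j + d).
  by rewrite /D mE; ring.
have bd0 : 0 < b j + d by rewrite ltr_pwDl.
have Ab : A * (d / (b j + d) ^+ 2) <= kappa * b j * (d / (b j + d) ^+ 2).
  rewrite ler_wpM2r ?divr_ge0 ?sqr_ge0 //.
  by apply: le_trans Akappa _; rewrite ler_wpM2l.
have tau0 : 0 <= tau j ^+ 2 by rewrite sqr_ge0.
have tauE : tau j = (b j + d)^-1.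
  by rewrite /tau Dn; field; rewrite gt_eqF //= gt_eqF.
set Q := \sum_(x in S) _ in Qge *.
set t := triples F e S in tri *.
have h : tau j ^+ 2 * (n * m - 2 * Q + t) <=
         tau j ^+ 2 * (n * m - 2 * (m ^+ 2 / n) + A * m).
  by rewrite ler_wpM2l //; lra.
apply: (@le_trans _ _ (2 * tau j * (n ^+ 2 - m) - tau j ^+ 2 *
  (b j * (n ^+ 2 - m)) - tau j ^+ 2 * (n * m - 2 * (m ^+ 2 / n) + A * m)));
  last by lra.
rewrite Dn tauE mE.
rewrite -subr_ge0.
rewrite (_ : _ - _ = n * (kappa * b j * (d / (b j + d) ^+ 2)
                          - A * (d / (b j + d) ^+ 2))).
  by rewrite mulr_ge0 ?subr_ge0 // ltW.
by field; rewrite (gt_eqF n0) (gt_eqF bd0).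
Qed.

End Potential.

(** * From the averaging inequality to stable sets *)

Section StableSets.
Context (T : finType) (e : rel T).
Implicit Types (S C : {set T}) (v : T).

Definition stable C : bool :=
  [forall c in C, forall c' in C, (c != c') ==> ~~ e c c'].

Definition stables S : {set {set T}} :=
  [set C : {set T} | stable C && (C \subset S)]%SET.

Lemma stableP C :
  reflect (forall c c', c \in C -> c' \in C -> c != c' -> ~~ e c c')
          (stable C).
Proof.
apply: (iffP forall_inP) => [h c c' cC c'C|h c cC].
  by move: (forall_inP (h c cC) c' c'C) => /implyP.
by apply/forall_inP => c' c'C; apply/implyP; exact: h.
Qed.

Lemma stable_sub C C' : C' \subset C -> stable C -> stable C'.
Proof.
move=> /fintype.subsetP sub /stableP h; apply/stableP => c c' cC c'C.
by apply: h; exact: sub.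
Qed.

Lemma stable0 : stable finset.set0.
Proof. by apply/stableP => c c'; rewrite inE. Qed.

Hypotheses (e_refl : reflexive e) (e_sym : symmetric e).

Lemma away_notin S v : v \notin away e S v.
Proof. by rewrite inE e_refl andbF. Qed.

Lemma away_sub S v : away e S v \subset S.
Proof. by apply/fintype.subsetP => x; rewrite inE => /andP[]. Qed.

Lemma away_proper S v : v \in S -> (#|away e S v| < #|S|)%N.
Proof.
move=> vS; apply: proper_card; apply/properP; split; first exact: away_sub.
by exists v; rewrite ?away_notin.
Qed.

Lemma stable_setU1 S v C :
  stable C -> C \subset away e S v -> stable (v |: C)%SET.
Proof.
move=> /stableP stC /fintype.subsetP CS; apply/stableP => c c'.
move=> /finset.setU1P[->|cC] /finset.setU1P[->|c'C].
- by rewrite eqxx.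
- by move: (CS _ c'C); rewrite inE => /andP[].
- by rewrite e_sym; move: (CS _ cC); rewrite inE => /andP[].
- exact: stC.
Qed.

Lemma setU1_sub_away S v C : v \in S -> C \subset away e S v ->
  (v |: C)%SET \subset S.
Proof.
move=> vS CS; rewrite finset.subUset finset.sub1set vS.
by rewrite (fintype.subset_trans CS) ?away_sub.
Qed.

Section Size.
Context (F : realFieldType) (Phi : {set T} -> F).
Hypothesis Phi0 : Phi finset.set0 = 0.
Hypothesis Phi_step : forall S,
  #|S|%:R * Phi S <= #|S|%:R + \sum_(v in S) Phi (away e S v).

(** Some deletion does at least as well as the average one, and its centre can
    be added to any stable set that avoids its ball. *)
Lemma stable_card_ge S :
  exists C, [/\ stable C, C \subset S & Phi S <= #|C|%:R].
Proof.
have [k kS] := ubnP #|S|; elim: k S kS => // k IH S kS.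
have [->|S0] := eqVneq S finset.set0.
  by exists finset.set0; rewrite stable0 finset.sub0set cards0 Phi0.
have [v vS hv] : exists2 v, v \in S & Phi S <= 1 + Phi (away e S v).
  apply/exists_inP; apply: contraT; rewrite negb_exists_in => /forall_inP h.
  have : \sum_(v in S) (1 + Phi (away e S v)) < \sum_(v in S) Phi S.
    have [x xS] := finset.set0Pn _ S0.
    rewrite (bigD1 x) //= [ltRHS](bigD1 x) //=; apply: ltr_leD.
      by rewrite ltNge h.
    by apply: ler_sum => y /andP[yS _]; rewrite ltW // ltNge h.
  rewrite big_split /= !sumr_const -[Phi S *+ _]mulr_natl ltNge.
  by rewrite Phi_step.
have [|C [stC CS hC]] := IH (away e S v).
  by apply: leq_trans (away_proper vS) _; rewrite -ltnS.
exists (v |: C)%SET; split; [exact: stable_setU1 CS|exact: setU1_sub_away|].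
rewrite cardsU1 (contraNN (fintype.subsetP CS v)) ?away_notin //= natrD.
by apply: le_trans hv _; rewrite lerD2l.
Qed.

End Size.

(** A stable set inside the set left after deleting the ball of v is a stable
    set containing v with v removed; each stable set is obtained so once for
    each of its points, hence at most M times. *)
Lemma sum_card_stables_away S (M : nat) :
  (forall C, stable C -> (#|C| <= M)%N) ->
  (\sum_(v in S) #|stables (away e S v)| <= M * #|stables S|)%N.
Proof.
move=> hM.
apply: (@leq_trans (\sum_(v in S) \sum_(C in stables S) (v \in C : nat))).
  apply: leq_sum => v vS.
  have notv C : C \subset away e S v -> v \in C = false.
    by move/fintype.subsetP => CS; apply: contraNF (away_notin S v) => /CS.
  have inj : {in stables (away e S v) &, injective (fun C => v |: C)%SET}.
    move=> C C'; rewrite !inE => /andP[_ CS] /andP[_ CS'] eqC.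
    apply/setP => x; move/setP/(_ x): eqC; rewrite !inE.
    case: eqVneq => //= -> _.
    by rewrite !notv.
  rewrite -(card_in_imset inj) -big_mkcondr sum1_card.
  apply: subset_leq_card; apply/fintype.subsetP => _ /imsetP[C + ->].
  rewrite inE => /andP[stC CS]; rewrite unfold_in /= !inE eqxx /= andbT.
  by rewrite (stable_setU1 stC CS) setU1_sub_away.
rewrite exchange_big /= mulnC -sum_nat_const; apply: leq_sum => C.
rewrite inE => /andP[stC CS]; apply: leq_trans (hM C stC).
rewrite -big_mkcondr sum1_card.
by apply: subset_leq_card; apply/fintype.subsetP => x /andP[].
Qed.

Section Count.
Context (R : realType) (Phi : {set T} -> R) (M ell c : R).
Hypothesis M_gt0 : 0 < M.
Hypothesis M_ge : forall C, stable C -> #|C|%:R <= M.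
Hypothesis ell_ge0 : 0 <= ell.
Hypothesis Phi_small : forall S, #|S|%:R <= M * expR ell -> Phi S <= c.
Hypothesis Phi_step : forall S,
  #|S|%:R * Phi S <= #|S|%:R + \sum_(v in S) Phi (away e S v).

(** By convexity of the exponential, the averaging inequality for Phi gives
    the one for the count: a deletion from a set S gains the factor #|S| / M,
    which is at least exp ell as long as the induction runs, and costs at most
    one unit of Phi on average. The constant c makes the bound trivial where
    it stops. *)
Lemma expR_le_card_stables S :
  expR (ell * (Phi S - c)) <= #|stables S|%:R.
Proof.
have [k kS] := ubnP #|S|; elim: k S kS => // k IH S kS.
have [small|big] := leP #|S|%:R (M * expR ell).
  apply: (@le_trans _ _ 1).
    by rewrite -expR0 ler_expR mulr_ge0_le0 // subr_le0 Phi_small.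
  rewrite ler1n card_gt0; apply/finset.set0Pn; exists finset.set0.
  by rewrite inE stable0 finset.sub0set.
set n : R := #|S|%:R in big *.
have n0 : 0 < n by apply: lt_trans big; rewrite mulr_gt0 ?expR_gt0.
set mu := ell * (Phi S - c).
(* Convexity of the exponential, in the form of its tangent at mu - ell. *)
have tangent x : expR (mu - ell) * (1 + x - (mu - ell)) <= expR x.
  have -> : expR x = expR (mu - ell) * expR (x - (mu - ell)).
    by rewrite -expRD; congr expR; ring.
  by rewrite ler_wpM2l ?expR_ge0 // -addrA expR_ge1Dx.
have avg : n * expR (mu - ell) <=
    \sum_(v in S) expR (ell * (Phi (away e S v) - c)).
  apply: le_trans (ler_sum _ (fun v _ => tangent _)).
  rewrite -mulr_sumr mulrC ler_wpM2l ?expR_ge0 //.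
  have const (x : R) : \sum_(v in S) x = n * x.
    by rewrite sumr_const mulr_natl.
  rewrite sumrB big_split /= -mulr_sumr sumrB !const mulr1.
  set s := \sum_(v in S) _.
  rewrite -subr_ge0 (_ : _ - _ = ell * (n + s - n * Phi S)).
    by rewrite mulr_ge0 // subr_ge0 Phi_step.
  by rewrite /mu; ring.
have cnt : \sum_(v in S) expR (ell * (Phi (away e S v) - c)) <=
    M * #|stables S|%:R.
  apply: (@le_trans _ _ (\sum_(v in S) #|stables (away e S v)|%:R)).
    apply: ler_sum => v vS; apply: IH.
    by apply: leq_trans (away_proper vS) _; rewrite -ltnS.
  rewrite -natr_sum.
  have hM C : stable C -> (#|C| <= Num.truncn M)%N.
    by move=> /M_ge h; rewrite truncn_ge_nat // ltW.
  apply: (@le_trans _ _ ((Num.truncn M * #|stables S|)%N%:R)).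
    by rewrite ler_nat; exact: sum_card_stables_away.
  by rewrite natrM ler_wpM2r ?ler0n // truncn_le ltW.
rewrite -(ler_pM2l M_gt0); apply: le_trans (le_trans avg cnt).
have -> : expR mu = expR (mu - ell) * expR ell.
  by rewrite -expRD; congr expR; ring.
by rewrite mulrCA mulrC ler_wpM2r ?expR_ge0 // ltW.
Qed.

End Count.

End StableSets.

(** * Choice of parameters *)

(** The progression has ratio 1 + h, starts at exp (- lam) * D, and is stopped
    at h * D, so that each of its terms adds little to the degree D. Its
    (lam + ln h) / h terms each contribute about h * #|S| / D. *)
Lemma exists_potential (R : realType) (T : finType) (e : rel T)
    (A D h lam : R) :
  symmetric e -> 0 <= A -> 0 < D -> 0 < h -> h <= 1 / 3 ->
  A <= h * (expR (- lam) * D) ->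
  (forall S : {set T}, triples R e S <= A * pairs R e S) ->
  exists Phi : {set T} -> R,
    [/\ Phi finset.set0 = 0,
        forall S : {set T},
          #|S|%:R * Phi S <= #|S|%:R + \sum_(v in S) Phi (away e S v),
        forall S : {set T}, Phi S <= #|S|%:R / (expR (- lam) * D) &
        forall S : {set T}, pairs R e S <= D * #|S|%:R ->
          #|S|%:R / D * ((1 - 3 * h) * (lam + ln h - h)) <= Phi S].
Proof.
move=> e_sym A0 D0 h0 h3 Ah tri.
set b0 := expR (- lam) * D in Ah *.
have b0_gt0 : 0 < b0 by rewrite mulr_gt0 ?expR_gt0.
pose rho := 1 + h; have rho1 : 1 < rho by rewrite ltrDl.
have rho0 : 0 < rho by apply: lt_trans rho1.
(* The largest weight allowed by potential_step with kappa = h. *)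
pose w := h / rho ^+ 2.
have w0 : 0 <= w by rewrite divr_ge0 ?sqr_ge0 // ltW.
have wE : w * rho = 1 - rho^-1.
  by rewrite /w /rho; field; rewrite gt_eqF.
pose J := Num.truncn ((lam + ln h) / h).
have J_small j : (j < J)%N -> b0 * rho ^+ j <= h * D.
  move=> jJ; have hj : j%:R * h <= lam + ln h.
    rewrite -ler_pdivlMr //; apply: (@le_trans _ _ J%:R).
      by rewrite ler_nat ltnW.
    rewrite truncn_le; apply: le_trans ler01 _.
    by rewrite -truncn_gt0; apply: leq_ltn_trans jJ.
  have rhoj : rho ^+ j <= expR (j%:R * h).
    rewrite expRM_natl lerXn2r ?nnegrE ?expR_ge0 ?(ltW rho0) //.
    exact: expR_ge1Dx.
  apply: (@le_trans _ _ (b0 * expR (lam + ln h))).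
    rewrite ler_wpM2l ?(ltW b0_gt0) //; apply: le_trans rhoj _.
    by rewrite ler_expR.
  rewrite /b0 mulrAC -expRD (_ : - lam + _ = ln h); last by ring.
  by rewrite lnK ?posrE.
exists (potential b0 rho e w J); split.
- exact: potential0.
- by move=> S; apply: (potential_step b0_gt0 rho1 e_sym J A0 Ah);
    rewrite -/rho ?wE.
- move=> S; apply: potential_le_card => //.
  by rewrite -wE ler_peMr // ltW.
- move=> S mS; have [->|S0] := eqVneq S finset.set0.
    by rewrite potential0 cards0 !mul0r.
  have n0 : 0 < #|S|%:R :> R by rewrite ltr0n card_gt0.
  set n : R := #|S|%:R in mS n0 *.
  apply: (@le_trans _ _ (w * \sum_(j < J) n / (rho * D))); last first.
    rewrite /potential ler_wpM2l //; apply: ler_sum => j _; rewrite -/n.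
    have bj0 : 0 < b0 * rho ^+ j by rewrite mulr_gt0 ?exprn_gt0.
    have den0 : 0 < b0 * rho ^+ j * n + pairs R e S.
      by rewrite ltr_pwDl ?pairs_ge0 // mulr_gt0.
    rewrite expr2 -mulrA ler_wpM2l ?(ltW n0) // -[leLHS]mul1r.
    rewrite ler_pdivlMr // mul1r ler_pdivrMl ?mulr_gt0 //.
    have := J_small j (ltn_ord j); rewrite /rho => hj.
    have : b0 * (1 + h) ^+ j * n <= h * D * n by rewrite ler_wpM2r ?(ltW n0).
    lra.
  have hJ : lam + ln h - h <= h * J%:R.
    have := truncnS_gt ((lam + ln h) / h); rewrite -/J ltr_pdivrMr //.
    by rewrite -natr1; lra.
  have -> : w * (\sum_(j < J) n / (rho * D)) = n / D * (h * J%:R / rho ^+ 3).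
    rewrite sumr_const card_ord -mulr_natl /w; field.
    by rewrite !gt_eqF.
  rewrite ler_wpM2l ?divr_ge0 ?(ltW n0) ?(ltW D0) //.
  have h3' : 0 <= 1 - 3 * h by lra.
  apply: (@le_trans _ _ ((1 - 3 * h) * (h * J%:R))); first by rewrite ler_wpM2l.
  rewrite mulrC ler_wpM2l ?mulr_ge0 ?ler0n ?(ltW h0) //.
  rewrite -[leRHS]mul1r ler_pdivlMr ?exprn_gt0 //.
  rewrite -subr_ge0 /rho (_ : _ - _ = h ^+ 2 * (6 + 8 * h + 3 * h ^+ 2)).
    by rewrite mulr_ge0 ?sqr_ge0 // !addr_ge0 ?mulr_ge0 ?sqr_ge0 // ltW.
  by ring.
Qed.

(** * Codes in homogeneous metric spaces *)

Section HomogeneousSpace.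
Context (R : realType) (X : finMetricType R) (r t K : R) (vol : R -> nat).
Hypotheses (r_gt0 : 0 < r) (t_lt_r : t < r).
Hypothesis volE : forall (s : R) (a : X), #|cball a s| = vol s.
Hypothesis growth : (vol (r - t))%:R / (vol r)%:R <= expR (- K).
Hypothesis small_cap : forall a b : X, r - t < mdist a b -> mdist a b <= r ->
  #|(cball a r :&: cball b r)%SET|%:R / (vol r)%:R <= expR (- K).

Let close : rel X := fun x y => mdist x y <= r.

Let close_refl : reflexive close.
Proof. by move=> x; rewrite /close mdistxx ltW. Qed.

Let close_sym : symmetric close.
Proof. by move=> x y; rewrite /close metric_sym. Qed.

Let is_code_stable (C : {set X}) : is_code r C = stable close C.
Proof.
apply: eq_forallb => c; congr (_ ==> _); apply: eq_forallb => c'.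
by rewrite /close -ltNge.
Qed.

Hypothesis x0 : X.

Let D : R := (vol r)%:R.
Let N : R := #|X|%:R / D.

Let vol_gt0 s : 0 <= s -> (0 < vol s)%N.
Proof.
move=> s0; rewrite -(volE s x0) card_gt0; apply/finset.set0Pn.
by exists x0; rewrite inE mdistxx.
Qed.

Let D_gt0 : 0 < D. Proof. by rewrite ltr0n vol_gt0 // ltW. Qed.

Let N_gt0 : 0 < N.
Proof. by rewrite divr_gt0 // ltr0n; apply/card_gt0P; exists x0. Qed.

(** The ball of radius r - t has at least one point, its centre. *)
Let expR_le_D : expR K <= D.
Proof.
have : 1 / D <= expR (- K).
  apply: le_trans growth; rewrite ler_wpM2r ?invr_ge0 ?(ltW D_gt0) //.
  by rewrite ler1n vol_gt0 // subr_ge0 ltW.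
rewrite ler_pdivrMr // => h.
rewrite -[leLHS]mulr1; apply: le_trans (ler_wpM2l (expR_ge0 K) h) _.
by rewrite mulrA -expRD subrr expR0 mul1r.
Qed.

Let card_close (x : X) : #|[set y | close x y]%SET|%:R = D.
Proof.
rewrite /D -(volE r x); congr (_%:R); apply: eq_card => y.
by rewrite !inE metric_sym.
Qed.

Let pairs_le (S : {set X}) : pairs R close S <= D * #|S|%:R.
Proof.
rewrite /pairs mulr_natr -sumr_const; apply: ler_sum => x _.
rewrite degE -(card_close x) ler_nat; apply: subset_leq_card.
by apply/fintype.subsetP => y; rewrite !inE => /andP[].
Qed.

Let triples_close (S : {set X}) :
  triples R close S <= 2 * (expR (- K) * D) * pairs R close S.
Proof.
apply: (triples_le (inner := fun x y => mdist x y <= r - t)).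
  move=> v; rewrite -ler_pdivrMr //; apply: le_trans growth.
  rewrite ler_wpM2r ?invr_ge0 ?(ltW D_gt0) // ler_nat -(volE _ v).
  apply: subset_leq_card; apply/fintype.subsetP => y.
  by rewrite !inE metric_sym.
move=> v x vx; rewrite -ltNge => rt; rewrite -ler_pdivrMr //.
apply: le_trans (small_cap rt vx).
rewrite ler_wpM2r ?invr_ge0 ?(ltW D_gt0) // ler_nat.
apply: subset_leq_card; apply/fintype.subsetP => y.
by rewrite !inE /close ![mdist y _]metric_sym.
Qed.

Let ln_le_sub1 (x : R) : 0 < x -> ln x <= x - 1.
Proof.
by move=> x_gt0; have := @le_ln1Dx R (x - 1); rewrite subrKC; apply; lra.
Qed.

(** Here h = 1 / sqrt K, and exp (- lam) * D is chosen as A / h, so that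
    lam = K - ln (2 * sqrt K); the corrections are then of order sqrt K. For
    sqrt K < 5 the bound is not positive. *)
Lemma large_code : 0 < K -> exists C : {set X}, is_code r C /\
  (1 - 5 / Num.sqrt K) * K * N <= #|C|%:R.
Proof.
move=> K0; set s := Num.sqrt K.
have s0 : 0 < s by rewrite sqrtr_gt0.
have KE : K = s ^+ 2 by rewrite sqr_sqrtr // ltW.
have [s5|s5] := ltP s 5.
  exists finset.set0; rewrite is_code_stable stable0 cards0; split=> //.
  rewrite mulr_le0_ge0 ?(ltW N_gt0) // mulr_le0_ge0 ?(ltW K0) //.
  by rewrite subr_le0 ler_pdivlMr // mul1r ltW.
have h0 : 0 < s^-1 by rewrite invr_gt0.
have hs : s^-1 <= 1 / 5 by rewrite div1r lef_pV2 ?posrE //; lra.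
have A_ge0 : 0 <= 2 * (expR (- K) * D).
  by rewrite mulr_ge0 // mulr_ge0 ?expR_ge0 // ltW.
have Ah : 2 * (expR (- K) * D) <=
    s^-1 * (expR (- (K - ln (2 * s))) * D).
  rewrite opprB addrC expRD lnK ?posrE ?mulr_gt0 // le_eqVlt; apply/orP; left.
  by apply/eqP; field; rewrite gt_eqF.
have h13 : s^-1 <= 1 / 3 by lra.
have [Phi [Phi0 step _ large]] :=
  exists_potential close_sym A_ge0 D_gt0 h0 h13 Ah triples_close.
have [C [stC _ hC]] :=
  stable_card_ge close_refl close_sym Phi0 step [set: X]%SET.
exists C; rewrite is_code_stable; split=> //; apply: le_trans hC.
apply: le_trans (large _ (pairs_le _)).
rewrite cardsT -/N mulrC ler_wpM2l ?(ltW N_gt0) //.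
rewrite lnM ?posrE // lnV ?posrE //.
have ln2 : ln 2 <= 2 - 1 :> R by apply: ln_le_sub1.
have lns := ln_le_sub1 s0.
have -> : (1 - 5 / s) * K = s ^+ 2 - 5 * s.
  by rewrite KE; field; rewrite gt_eqF.
apply: (@le_trans _ _ ((1 - 3 * s^-1) * (s ^+ 2 - 2 * s))).
  rewrite [leRHS](_ : _ = s ^+ 2 - 5 * s + 6); first by lra.
  by field; rewrite gt_eqF.
rewrite ler_wpM2l //; last by rewrite -KE; lra.
lra.
Qed.

(** The threshold on K makes K ^ 2 <= exp (K / 8), through
    exp (K / 8) >= (K / 24) ^ 3. With h = 1 / 12 the potential of the space is
    at least 3 K / 8 - O(1) times |X| / vol r, which leaves room above 1 / 8. *)
Lemma many_codes : 24 * 600 <= K ->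
  expR (1 / 8 * K ^+ 2 * N) <= #|[set C : {set X} | is_code r C]%SET|%:R.
Proof.
move=> K_ge.
have K0 : 0 < K by apply: lt_le_trans K_ge; lra.
have -> : [set C : {set X} | is_code r C]%SET = stables close [set: X]%SET.
  by apply/setP => C; rewrite !inE is_code_stable finset.subsetT andbT.
pose M := K ^+ 2 * N.
have M0 : 0 < M by rewrite mulr_gt0 ?exprn_gt0.
(* All subsets of a code are codes, so one with more than M points suffices. *)
have [/exists_inP[C stC CM]|/exists_inPn small] :=
    boolP [exists C : {set X} in stable close, M < #|C|%:R].
  apply: (@le_trans _ _ (2 ^+ #|C|)).
    apply: (@le_trans _ _ (expR (#|C|%:R * (1 / 2)))).
      by rewrite ler_expR -/M -mulrA -/M; lra.
    rewrite expRM_natl lerXn2r ?nnegrE ?expR_ge0 //.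
    have : 1 / 2 <= expR (- (1 / 2)) :> R.
      by apply: le_trans (expR_ge1Dx _); lra.
    by rewrite expRN -[leRHS]div1r ler_pdivlMr ?expR_gt0 //; lra.
  rewrite -natrX ler_nat -card_powerset; apply: subset_leq_card.
  apply/fintype.subsetP => C'; rewrite !inE finset.subsetT andbT => sub.
  exact: stable_sub stC.
have sizeM (C : {set X}) : stable close C -> #|C|%:R <= M.
  by move=> /small; rewrite -leNgt.
have A_ge0 : 0 <= 2 * (expR (- K) * D).
  by rewrite mulr_ge0 // mulr_ge0 ?expR_ge0 // ltW.
have h0 : 0 < 1 / 12 :> R by lra.
have h13 : 1 / 12 <= 1 / 3 :> R by lra.
have Ah : 2 * (expR (- K) * D) <= 1 / 12 * (expR (- (K / 2)) * D).
  set u := expR (- (K / 2)).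
  have -> : expR (- K) = u * u by rewrite -expRD; congr expR; lra.
  have u_le : u <= 1 / 24.
    have : 24 <= expR (K / 2) by apply: le_trans (expR_ge1Dx _); lra.
    by rewrite /u expRN div1r lef_pV2 ?posrE ?expR_gt0.
  rewrite -subr_ge0 (_ : _ - _ = u * D * (1 / 12 - 2 * u)); last by ring.
  by rewrite mulr_ge0 ?mulr_ge0 ?expR_ge0 ?(ltW D_gt0) //; lra.
have [Phi [Phi0 step Phi_le large]] :=
  exists_potential close_sym A_ge0 D_gt0 h0 h13 Ah triples_close.
pose ell := 3 / 8 * K.
have Phi_small (S : {set X}) : #|S|%:R <= M * expR ell -> Phi S <= N.
  move=> hS; apply: le_trans (Phi_le S) _.
  rewrite ler_pdivrMr ?mulr_gt0 ?expR_gt0 //.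
  apply: le_trans hS _; rewrite /M mulrAC mulrC ler_pM2l //.
  have cube : K ^+ 2 <= expR (K / 8).
    apply: (@le_trans _ _ ((K / 24) ^+ 3)).
      have y_ge : 24 * 24 <= K / 24 by lra.
      have {1}-> : K = 24 * (K / 24) by lra.
      set y := K / 24 in y_ge *.
      rewrite -subr_ge0 (_ : _ - _ = y ^+ 2 * (y - 24 * 24)); last by ring.
      by rewrite mulr_ge0 ?sqr_ge0 ?subr_ge0.
    have -> : K / 8 = 3%:R * (K / 24) by lra.
    rewrite expRM_natl lerXn2r ?nnegrE ?expR_ge0 ?divr_ge0 ?(ltW K0) //.
    by apply: le_trans (expR_ge1Dx _); lra.
  apply: (@le_trans _ _ (expR (- (K / 2)) * expR K)); last first.
    by rewrite ler_wpM2l ?expR_ge0.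
  rewrite -expRD (_ : - (K / 2) + K = K / 8 + ell); last by rewrite /ell; lra.
  by rewrite expRD ler_wpM2r ?expR_ge0.
have ell0 : 0 <= ell by rewrite /ell; lra.
apply: le_trans (expR_le_card_stables close_refl close_sym M0 sizeM ell0
  Phi_small step [set: X]%SET).
rewrite ler_expR.
have := large _ (pairs_le [set: X]%SET); rewrite cardsT -/N => large'.
have ln12 : ln 12 <= 12 - 1 :> R by apply: ln_le_sub1; lra.
have lnh : ln (1 / 12) = - ln 12 :> R by rewrite div1r lnV ?posrE //; lra.
apply: (@le_trans _ _ (ell * (N * (3 / 8 * K - 9) - N))); last first.
  rewrite ler_wpM2l // lerD2r; apply: le_trans large'.
  by rewrite ler_wpM2l ?(ltW N_gt0) // lnh; lra.
rewrite -subr_ge0 /ell.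
rewrite (_ : _ - _ = N * (K * (K / 64 - 15 / 4))); last by field.
by rewrite mulr_ge0 ?(ltW N_gt0) // mulr_ge0 ?(ltW K0) //; lra.
Qed.

End HomogeneousSpace.

Local Open Scope classical_set_scope.

Theorem theorem2p4 (R : realType) :
  exists delta1 delta2 : R -> R,
    [/\ delta1 K @[K --> +oo] --> (0 : R),
        delta2 K @[K --> +oo] --> (0 : R) &
        forall (X : finMetricType R) (r : R), 0 < r ->
        forall vol : R -> nat,
          (forall (s : R) (a : X), #|cball a s| = vol s) ->
        forall t K : R, 0 < t -> t < r -> 0 < K ->
          (vol (r - t))%:R / (vol r)%:R <= expR (- K) ->
          (forall a b : X, r - t < mdist a b -> mdist a b <= r ->
             #|(cball a r :&: cball b r)%SET|%:R / (vol r)%:R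
               <= expR (- K)) ->
          (exists C : {set X}, is_code r C /\
             (1 - delta1 K) * K * (#|X|%:R / (vol r)%:R) <= #|C|%:R) /\
          expR ((1 / 8 + delta2 K) * K ^+ 2 * (#|X|%:R / (vol r)%:R))
            <= #|[set C : {set X} | is_code r C]%SET|%:R].
Proof.
exists (fun K => 5 / Num.sqrt K).
(* Below the threshold the second exponent is made zero, as the empty code is
   a code; above it no error term is left. *)
exists (fun K => if K < 24 * 600 then - (1 / 8) else 0).
split.
- apply/cvgrPdist_le => eps eps0; near=> K.
  have K_ge : (5 / eps) ^+ 2 <= K.
    by near: K; apply: nbhs_pinfty_ge; exact: num_real.
  have s_ge : 5 / eps <= Num.sqrt K.
    have q0 : 0 <= 5 / eps by rewrite divr_ge0 // ltW.
    by rewrite -(ger0_norm q0) -sqrtr_sqr ler_wsqrtr.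
  have s0 : 0 < Num.sqrt K by apply: lt_le_trans s_ge; rewrite divr_gt0.
  rewrite sub0r normrN ger0_norm ?divr_ge0 ?sqrtr_ge0 //.
  by rewrite ler_pdivrMr // mulrC -ler_pdivrMr.
- apply: cvg_near_cst; near=> K; apply/eqP.
  rewrite ifF //; apply/negbTE; rewrite -leNgt.
  by near: K; apply: nbhs_pinfty_ge; exact: num_real.
move=> X r r0 vol volE t K t0 tr K0 growth small_cap.
have code0 : is_code r (finset.set0 : {set X}).
  by apply/forall_inP => c; rewrite inE.
have one_le : 1 <= #|[set C : {set X} | is_code r C]%SET|%:R :> R.
  by rewrite ler1n; apply/card_gt0P; exists finset.set0; rewrite inE.
have [X0|/card_gt0P[x0 _]] := posnP #|X|.
  rewrite X0 !mul0r !mulr0 expR0; split=> //.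
  by exists finset.set0; rewrite code0 cards0.
split; first exact: large_code growth small_cap x0 K0.
case: ltP => K_ge; first by rewrite addrN !mul0r expR0.
by rewrite addr0; exact: many_codes growth small_cap x0 K_ge.
Unshelve. all: by end_near.
Qed.
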